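(* Let $\mathbb{C}$ be a finitely complete $\mathsf{Ord}$-enriched category which admits comma objects and $2$-pullbacks. The following statements are equivalent: (i) The vertical comma object functor $V_{\alpha}\colon \mathsf{Pt}_Y(\mathbb{C})\to \mathsf{Pt}_A(\mathbb{C})$ is conservative for every morphism $\alpha\colon A\to Y$ of $\mathbb{C}$. (ii) For all morphisms $\alpha\colon A\to Y$, $\beta\colon Y\to V$, $f\colon X\to Y$, $s\colon Y\to X$, $g\colon U\to V$, $t\colon V\to U$, $\chi\colon X\to U$ of $\mathbb{C}$ with $fs=1_Y$, $gt=1_V$, $\beta f=g\chi$ and $\chi s=t\beta$, and with $(\alpha/f,\pi_1\colon\alpha/f\to A,\pi_2\colon\alpha/f\to X)$ the comma object of $(\alpha,f)$ (regarded as a point over $A$ via $\pi_1$ and its section $i_1=\langle 1_A,s\alpha\rangle$): if $(\alpha/f,\ \pi_1,\ \chi\pi_2)$ is a comma object of $(\beta\alpha, g)$, then the commutative square $\beta f=g\chi$ is a $2$-pullback, i.e. $(X,f,\chi)$ is a $2$-pullback of $(\beta,g)$.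
   Context: $\mathsf{Ord}$ is the category of preordered sets (reflexive, transitive relations) and monotone maps. An $\mathsf{Ord}$-enriched category $\mathbb{C}$ is a category whose hom-sets $\mathbb{C}(X,Y)$ carry a preorder $\preccurlyeq$ preserved by pre- and postcomposition. ''Finitely complete'' means that it has finite limits. Comma object of an ordered pair $(f\colon X\to Y,\ g\colon Z\to Y)$: an object $f/g$ with morphisms $\pi_1\colon f/g\to X$, $\pi_2\colon f/g\to Z$ such that (C1) $f\pi_1\preccurlyeq g\pi_2$; (C2) for all $a\colon A\to X$, $b\colon A\to Z$ with $fa\preccurlyeq gb$ there is a unique $\lambda=\langle a,b\rangle\colon A\to f/g$ with $\pi_1\lambda=a$, $\pi_2\lambda=b$; (C3) if $fa\preccurlyeq gb$, $fa'\preccurlyeq gb'$, $a\preccurlyeq a'$ and $b\preccurlyeq b'$, then $\langle a,b\rangle\preccurlyeq\langle a',b'\rangle$. ''$\mathbb{C}$ admits comma objects'' means that every such pair has one. A $2$-pullback of $(f\colon X\to Y,g\colon Z\to Y)$ is a pullback $(P,p_1\colon P\to X,p_2\colon P\to Z)$ such that, for $u,v\colon A\to P$, $p_1u\preccurlyeq p_1v$ and $p_2u\preccurlyeq p_2v$ imply $u\preccurlyeq v$. A point over $Y$ is a pair $(f\colon X\to Y,\ s\colon Y\to X)$ with $fs=1_Y$. $\mathsf{Pt}_Y(\mathbb{C})$ is the category of points over $Y$; a morphism $\gamma\colon(g\colon Z\to Y,t)\to(f\colon X\to Y,s)$ is a morphism $\gamma\colon Z\to X$ with $f\gamma=g$ and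 $\gamma t=s$. For $\alpha\colon A\to Y$, the vertical comma object change-of-base functor $V_\alpha\colon\mathsf{Pt}_Y(\mathbb{C})\to\mathsf{Pt}_A(\mathbb{C})$ sends $(f,s)$ to the point $(\pi_1\colon\alpha/f\to A,\ \langle 1_A,s\alpha\rangle\colon A\to\alpha/f)$, where $(\alpha/f,\pi_1,\pi_2)$ is the comma object of $(\alpha,f)$, and sends $\gamma\colon(g,t)\to(f,s)$ to the morphism $\alpha/g\to\alpha/f$ induced by the universal property, namely $\langle\rho_1,\gamma\rho_2\rangle$ with $\rho_1,\rho_2$ the projections of $\alpha/g$. A functor is conservative if it reflects isomorphisms. *)

(* Defs.v *)
From Stdlib Require Import ClassicalEpsilon ProofIrrelevance FinFun.

Set Implicit Arguments.
Unset Strict Implicit.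
Unset Printing Implicit Defensive.

Record category := Category {
  obj :> Type;
  hom : obj -> obj -> Type;
  idm : forall X, hom X X;
  comp : forall X Y Z, hom Y Z -> hom X Y -> hom X Z;
  comp_idl : forall X Y (f : hom X Y), comp (idm Y) f = f;
  comp_idr : forall X Y (f : hom X Y), comp f (idm X) = f;
  comp_assoc : forall W X Y Z (h : hom Y Z) (g : hom X Y) (f : hom W X),
    comp h (comp g f) = comp (comp h g) f
}.

Arguments hom {c} X Y.
Arguments idm {c} X.

Declare Scope cat_scope.
Delimit Scope cat_scope with cat.
Open Scope cat_scope.

Notation "g ∘ f" := (comp g f) (at level 40, left associativity) : cat_scope.

Definition is_iso (C : category) (X Y : C) (f : hom X Y) : Prop :=
  exists g : hom Y X, g ∘ f = idm X /\ f ∘ g = idm Y.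

Record functor (C D : category) := Functor {
  fobj :> C -> D;
  fmap : forall X Y : C, hom X Y -> hom (fobj X) (fobj Y);
  fmap_id : forall X : C, fmap (idm X) = idm (fobj X);
  fmap_comp : forall (X Y Z : C) (g : hom Y Z) (f : hom X Y),
    fmap (g ∘ f) = fmap g ∘ fmap f
}.

Arguments fmap {C D} _ {X Y} _.

Definition conservative (C D : category) (F : functor C D) : Prop :=
  forall (X Y : C) (f : hom X Y), is_iso (fmap F f) -> is_iso f.

Definition finite_category (J : category) : Prop :=
  Finite J /\ forall i j : J, Finite (hom i j).

Record cone (J C : category) (D : functor J C) := Cone {
  apex : C;
  leg : forall j : J, hom apex (D j);
  leg_natural : forall (i j : J) (u : hom i j), fmap D u ∘ leg i = leg j
}.

Definition is_limit (J C : category) (D : functor J C) (K : cone D) : Prop :=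
  forall K' : cone D,
    exists! h : hom (apex K') (apex K), forall j : J, leg K j ∘ h = leg K' j.

Definition finitely_complete (C : category) : Prop :=
  forall J : category, finite_category J ->
  forall D : functor J C, exists K : cone D, is_limit K.

Record ord_category := OrdCategory {
  ord_cat :> category;
  le : forall X Y : ord_cat, hom X Y -> hom X Y -> Prop;
  le_refl : forall (X Y : ord_cat) (f : hom X Y), le f f;
  le_trans : forall (X Y : ord_cat) (f g h : hom X Y),
    le f g -> le g h -> le f h;
  le_postcomp : forall (X Y Z : ord_cat) (h : hom Y Z) (f g : hom X Y),
    le f g -> le (h ∘ f) (h ∘ g);
  le_precomp : forall (X Y Z : ord_cat) (f g : hom Y Z) (h : hom X Y),
    le f g -> le (f ∘ h) (g ∘ h)
}.

Notation "f ≼ g" := (le f g) (at level 70, no associativity) : cat_scope.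

Section Comma.

Variables (C : ord_category) (X Y Z : C) (f : hom X Y) (g : hom Z Y).

(* [l] is the morphism denoted <a, b> *)
Definition induces (P : C) (p1 : hom P X) (p2 : hom P Z)
    (A : C) (a : hom A X) (b : hom A Z) (l : hom A P) : Prop :=
  p1 ∘ l = a /\ p2 ∘ l = b.

Record is_comma (P : C) (p1 : hom P X) (p2 : hom P Z) : Prop := IsComma {
  comma_le : f ∘ p1 ≼ g ∘ p2;
  comma_univ : forall (A : C) (a : hom A X) (b : hom A Z),
    f ∘ a ≼ g ∘ b -> exists! l : hom A P, induces p1 p2 a b l;
  comma_mono : forall (A : C) (a a' : hom A X) (b b' : hom A Z)
      (l l' : hom A P),
    f ∘ a ≼ g ∘ b -> f ∘ a' ≼ g ∘ b' -> a ≼ a' -> b ≼ b' ->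
    induces p1 p2 a b l -> induces p1 p2 a' b' l' -> l ≼ l'
}.

Record comma_object := CommaObject {
  comma_obj :> C;
  comma_pi1 : hom comma_obj X;
  comma_pi2 : hom comma_obj Z;
  comma_objP : is_comma comma_pi1 comma_pi2
}.

Definition comma_pair (K : comma_object) (A : C) (a : hom A X) (b : hom A Z)
    (le_ab : f ∘ a ≼ g ∘ b) : hom A K :=
  proj1_sig (constructive_definite_description _
    (comma_univ (comma_objP K) le_ab)).

Lemma comma_pairP (K : comma_object) (A : C) (a : hom A X) (b : hom A Z)
    (le_ab : f ∘ a ≼ g ∘ b) :
  induces (comma_pi1 K) (comma_pi2 K) a b (comma_pair K le_ab).
Proof.
  unfold comma_pair.
  exact (proj2_sig (constructive_definite_description _
    (comma_univ (comma_objP K) le_ab))).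
Qed.

Lemma comma_ext (K : comma_object) (A : C) (l l' : hom A K) :
  comma_pi1 K ∘ l = comma_pi1 K ∘ l' -> comma_pi2 K ∘ l = comma_pi2 K ∘ l' ->
  l = l'.
Proof.
  intros E1 E2.
  assert (L : f ∘ (comma_pi1 K ∘ l) ≼ g ∘ (comma_pi2 K ∘ l)).
  { rewrite !comp_assoc. apply le_precomp, (comma_le (comma_objP K)). }
  destruct (comma_univ (comma_objP K) L) as [m [_ U]].
  transitivity m; [symmetry|]; apply U; split; congruence.
Qed.

Record is_pullback (P : C) (p1 : hom P X) (p2 : hom P Z) : Prop := IsPullback {
  pullback_comm : f ∘ p1 = g ∘ p2;
  pullback_univ : forall (A : C) (a : hom A X) (b : hom A Z),
    f ∘ a = g ∘ b -> exists! l : hom A P, induces p1 p2 a b l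
}.

Definition is_2pullback (P : C) (p1 : hom P X) (p2 : hom P Z) : Prop :=
  is_pullback p1 p2 /\
  forall (A : C) (u v : hom A P),
    p1 ∘ u ≼ p1 ∘ v -> p2 ∘ u ≼ p2 ∘ v -> u ≼ v.

End Comma.

Arguments comma_pi1 {C X Y Z f g} _.
Arguments comma_pi2 {C X Y Z f g} _.
Arguments comma_pair {C X Y Z f g} K {A a b} le_ab.

(* Data rather than a mere existence statement: the vertical comma object
   functors depend on a choice of comma objects. *)
Definition comma_objects (C : ord_category) : Type :=
  forall (X Y Z : C) (f : hom X Y) (g : hom Z Y), comma_object f g.

Definition admits_2pullbacks (C : ord_category) : Prop :=
  forall (X Y Z : C) (f : hom X Y) (g : hom Z Y),
    exists (P : C) (p1 : hom P X) (p2 : hom P Z), is_2pullback f g p1 p2.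

Section Points.

Variables (C : category) (Y : C).

Record point := Point {
  pt_dom : C;
  pt_map : hom pt_dom Y;
  pt_sec : hom Y pt_dom;
  pt_secK : pt_map ∘ pt_sec = idm Y
}.

Record point_hom (q p : point) := PointHom {
  pt_mor :> hom (pt_dom q) (pt_dom p);
  pt_mor_map : pt_map p ∘ pt_mor = pt_map q;
  pt_mor_sec : pt_mor ∘ pt_sec q = pt_sec p
}.

Lemma point_hom_eq (q p : point) (u v : point_hom q p) :
  pt_mor u = pt_mor v -> u = v.
Proof.
  destruct u as [u u1 u2], v as [v v1 v2]; simpl; intros E; subst v.
  f_equal; apply proof_irrelevance.
Qed.

Definition point_id (p : point) : point_hom p p :=
  PointHom (comp_idr (pt_map p)) (comp_idl (pt_sec p)).

Definition point_comp (r q p : point) (v : point_hom q p) (u : point_hom r q) :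
  point_hom r p.
Proof.
  refine (@PointHom r p (pt_mor v ∘ pt_mor u) _ _).
  - now rewrite comp_assoc, !pt_mor_map.
  - now rewrite <- comp_assoc, !pt_mor_sec.
Defined.

Definition Pt : category.
Proof.
  refine (@Category point point_hom point_id point_comp _ _ _);
    intros; apply point_hom_eq; simpl.
  - apply comp_idl.
  - apply comp_idr.
  - apply comp_assoc.
Defined.

End Points.

Section Vertical.

Variables (C : ord_category) (cm : comma_objects C).
Variables (A Y : C) (alpha : hom A Y).

Lemma vertical_sec_le (p : point Y) :
  alpha ∘ idm A ≼ pt_map p ∘ (pt_sec p ∘ alpha).
Proof.
  rewrite comp_assoc, pt_secK, comp_idl, comp_idr.
  apply le_refl.
Qed.

Lemma vertical_mor_le (q p : point Y) (u : point_hom q p)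
    (K : comma_object alpha (pt_map q)) :
  alpha ∘ comma_pi1 K ≼ pt_map p ∘ (pt_mor u ∘ comma_pi2 K).
Proof.
  rewrite comp_assoc, pt_mor_map.
  apply (comma_le (comma_objP K)).
Qed.

Definition vertical_point (p : point Y) : point A :=
  let K := cm alpha (pt_map p) in
  Point (proj1 (comma_pairP K (vertical_sec_le p))).

Definition vertical_mor (q p : point Y) (u : point_hom q p) :
  point_hom (vertical_point q) (vertical_point p).
Proof.
  refine (@PointHom C A (vertical_point q) (vertical_point p)
    (comma_pair (cm alpha (pt_map p))
       (vertical_mor_le u (cm alpha (pt_map q)))) _ _).
  - exact (proj1 (comma_pairP _ _)).
  - simpl.
    destruct (comma_pairP (cm alpha (pt_map p))
      (vertical_mor_le u (cm alpha (pt_map q)))) as [M1 M2].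
    destruct (comma_pairP (cm alpha (pt_map q)) (vertical_sec_le q))
      as [S1 S2].
    destruct (comma_pairP (cm alpha (pt_map p)) (vertical_sec_le p))
      as [T1 T2].
    apply comma_ext; rewrite comp_assoc.
    + now rewrite M1, S1, T1.
    + now rewrite M2, T2, <- comp_assoc, S2, comp_assoc, pt_mor_sec.
Defined.

Definition vertical : functor (Pt Y) (Pt A).
Proof.
  refine (@Functor (Pt Y) (Pt A) vertical_point vertical_mor _ _).
  - intros p; apply point_hom_eq; simpl.
    apply comma_ext; rewrite comp_idr.
    + exact (proj1 (comma_pairP _ _)).
    + now rewrite (proj2 (comma_pairP _ _)); simpl; rewrite comp_idl.
  - intros r q p v u; apply point_hom_eq; simpl.
    destruct (comma_pairP (cm alpha (pt_map p))
      (vertical_mor_le v (cm alpha (pt_map q)))) as [V1 V2].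
    destruct (comma_pairP (cm alpha (pt_map q))
      (vertical_mor_le u (cm alpha (pt_map r)))) as [U1 U2].
    apply comma_ext; rewrite comp_assoc.
    + now rewrite V1, U1, (proj1 (comma_pairP _ _)).
    + rewrite V2, <- comp_assoc, U2, (proj2 (comma_pairP _ _)); simpl.
      symmetry; apply comp_assoc.
Defined.

End Vertical.

(* Main.v *)
Require Import Defs.

Set Implicit Arguments.
Unset Strict Implicit.
Unset Printing Implicit Defensive.

(** The square is compared with a genuine 2-pullback [P] of [beta] and [g].
    The point [(f, s)] maps to the point [(p1, <1, t beta>)] over [Y] by
    [gamma = <f, chi>], and the square is a 2-pullback as soon as [gamma] is
    invertible. When vertical comma functors are conservative it is enough to
    invert [V_alpha gamma].

    In terms of generalised elements, [alpha/p1] consists of triples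
    [(a, y, u)] with [alpha a ≼ y] and [beta y = g u], and the hypothesis says
    that every pair [(a, u)] with [beta alpha a ≼ g u] comes from exactly one
    [x] with [alpha a ≼ f x] and [chi x = u]. This sends [(a, y, u)] to
    [(a, x)] in [alpha/f], a candidate for the inverse; the only doubtful point
    is whether [f x = y]. Both have the same image under [beta], both lie above
    [alpha a], and the sections turn this into an equality: [s y] and
    [s (f x)] lie over the same pair [(a, t beta y)], so they coincide
    ([comma_paste_base_inj]).

    Conversely, a morphism of points [gamma] over [Y] is a square of this kind
    with [beta] the identity. If [V_alpha gamma] is invertible, it transports
    the comma property, so the square is a 2-pullback along an identity, which
    forces [gamma] to be invertible. *)

(** * Limits transported along isomorphisms *)

Lemma is_pullback_ext (C : ord_category) (X Y Z : C) (f : hom X Y)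
    (g : hom Z Y) (P : C) (p1 : hom P X) (p2 : hom P Z)
    (HP : is_pullback f g p1 p2) (A : C) (u v : hom A P) :
  p1 ∘ u = p1 ∘ v -> p2 ∘ u = p2 ∘ v -> u = v.
Proof.
  intros E1 E2.
  assert (L : f ∘ (p1 ∘ u) = g ∘ (p2 ∘ u)).
  { now rewrite !comp_assoc, (pullback_comm HP). }
  destruct (pullback_univ HP L) as [m [_ U]].
  transitivity m; [symmetry|]; apply U; split; congruence.
Qed.

Lemma is_2pullback_precomp_iso (C : ord_category) (X Y Z : C) (f : hom X Y)
    (g : hom Z Y) (P Q : C) (p1 : hom P X) (p2 : hom P Z) (i : hom Q P) :
  is_2pullback f g p1 p2 -> is_iso i -> is_2pullback f g (p1 ∘ i) (p2 ∘ i).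
Proof.
  intros [HP HO] [j [ji ij]].
  assert (cancel : forall (T : C) (u : hom T Q), j ∘ (i ∘ u) = u).
  { intros T u; now rewrite comp_assoc, ji, comp_idl. }
  split; [split|].
  - now rewrite !comp_assoc, (pullback_comm HP).
  - intros T a b E.
    destruct (pullback_univ HP E) as [l [[L1 L2] U]].
    exists (j ∘ l); split.
    + split; rewrite <- comp_assoc, (comp_assoc i), ij, comp_idl; assumption.
    + intros m [M1 M2].
      rewrite (U (i ∘ m)); [apply cancel|].
      now split; rewrite comp_assoc.
  - intros T u v L1 L2.
    rewrite <- (cancel _ u), <- (cancel _ v).
    apply le_postcomp, HO; rewrite !comp_assoc; assumption.
Qed.

Lemma is_comma_precomp_iso (C : ord_category) (X Y Z : C) (f : hom X Y)
    (g : hom Z Y) (P Q : C) (p1 : hom P X) (p2 : hom P Z) (i : hom Q P) :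
  is_comma f g p1 p2 -> is_iso i -> is_comma f g (p1 ∘ i) (p2 ∘ i).
Proof.
  intros HP [j [ji ij]].
  assert (cancel : forall (T : C) (u : hom T Q), j ∘ (i ∘ u) = u).
  { intros T u; now rewrite comp_assoc, ji, comp_idl. }
  split.
  - rewrite !comp_assoc. apply le_precomp, (comma_le HP).
  - intros T a b E.
    destruct (comma_univ HP E) as [l [[L1 L2] U]].
    exists (j ∘ l); split.
    + split; rewrite <- comp_assoc, (comp_assoc i), ij, comp_idl; assumption.
    + intros m [M1 M2].
      rewrite (U (i ∘ m)); [apply cancel|].
      now split; rewrite comp_assoc.
  - intros T a a' b b' l l' H H' La Lb [I1 I2] [I1' I2'].
    rewrite <- (cancel _ l), <- (cancel _ l').
    apply le_postcomp, (comma_mono HP H H' La Lb);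
      split; rewrite comp_assoc; assumption.
Qed.

Lemma is_pullback_along_id_iso (C : ord_category) (X Y Z : C) (f : hom X Y)
    (p1 : hom Z Y) (p2 : hom Z X) :
  is_pullback (idm Y) f p1 p2 -> is_iso p2.
Proof.
  intros HP.
  assert (E : idm Y ∘ f = f ∘ idm X) by now rewrite comp_idl, comp_idr.
  destruct (pullback_univ HP E) as [j [[J1 J2] _]].
  exists j; split; [|assumption].
  apply (is_pullback_ext HP); rewrite comp_assoc, comp_idr.
  - rewrite J1, <- (pullback_comm HP); apply comp_idl.
  - rewrite J2; apply comp_idl.
Qed.

(** * Isomorphisms of points *)

Lemma point_hom_iso (C : category) (Y : C) (q p : Pt Y) (u : hom q p) :
  is_iso (pt_mor u) <-> is_iso u.
Proof.
  split.
  - intros [v [vu uv]].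
    assert (V1 : pt_map q ∘ v = pt_map p).
    { now rewrite <- (pt_mor_map u), <- comp_assoc, uv, comp_idr. }
    assert (V2 : v ∘ pt_sec p = pt_sec q).
    { now rewrite <- (pt_mor_sec u), comp_assoc, vu, comp_idl. }
    exists (PointHom V1 V2 : hom p q).
    split; apply point_hom_eq; assumption.
  - intros [v [vu uv]].
    exists (pt_mor v).
    split; [exact (f_equal (fun w => pt_mor w) vu)
           | exact (f_equal (fun w => pt_mor w) uv)].
Qed.

Lemma vertical_fmapP (C : ord_category) (cm : comma_objects C) (A Y : C)
    (alpha : hom A Y) (q p : Pt Y) (u : hom q p) :
  induces (comma_pi1 (cm A Y _ alpha (pt_map p)))
    (comma_pi2 (cm A Y _ alpha (pt_map p)))
    (comma_pi1 (cm A Y _ alpha (pt_map q)))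
    (pt_mor u ∘ comma_pi2 (cm A Y _ alpha (pt_map q)))
    (pt_mor (fmap (vertical cm alpha) u)).
Proof. exact (comma_pairP _ _). Qed.

(** * Comma objects pasted with a commutative square *)

Section Paste.

Variables (C : ord_category) (A Y V X U : C).
Variables (alpha : hom A Y) (beta : hom Y V).
Variables (f : hom X Y) (g : hom U V) (chi : hom X U).
Hypothesis square : beta ∘ f = g ∘ chi.
Variable K : comma_object alpha f.
Hypothesis HK : is_comma (beta ∘ alpha) g (comma_pi1 K) (chi ∘ comma_pi2 K).

Lemma comma_paste_lift (T : C) (a : hom T A) (u : hom T U) :
  beta ∘ alpha ∘ a ≼ g ∘ u ->
  exists x : hom T X, alpha ∘ a ≼ f ∘ x /\ chi ∘ x = u.
Proof.
  intros L.
  destruct (comma_univ HK L) as [l [[L1 L2] _]].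
  exists (comma_pi2 K ∘ l); split.
  - rewrite <- L1, !comp_assoc. apply le_precomp, (comma_le (comma_objP K)).
  - now rewrite comp_assoc.
Qed.

Lemma comma_paste_inj (T : C) (a : hom T A) (x x' : hom T X) :
  alpha ∘ a ≼ f ∘ x -> alpha ∘ a ≼ f ∘ x' -> chi ∘ x = chi ∘ x' -> x = x'.
Proof.
  intros L L' E.
  destruct (comma_pairP K L) as [I1 I2].
  destruct (comma_pairP K L') as [I1' I2'].
  assert (LU : beta ∘ alpha ∘ a ≼ g ∘ (chi ∘ x)).
  { rewrite comp_assoc, <- square, <- !comp_assoc. now apply le_postcomp. }
  destruct (comma_univ HK LU) as [m [_ M]].
  rewrite <- I2, <- I2'. f_equal.
  transitivity m; [symmetry|]; apply M; split; trivial;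
    rewrite <- comp_assoc; congruence.
Qed.

(** The section [s] lifts [y] and [y'] to elements of [X] with the common
    image [t beta y] in [U], where uniqueness of lifts applies. *)
Lemma comma_paste_base_inj (s : hom Y X) (t : hom V U) (T : C) (a : hom T A)
    (y y' : hom T Y) :
  f ∘ s = idm Y -> chi ∘ s = t ∘ beta ->
  alpha ∘ a ≼ y -> alpha ∘ a ≼ y' -> beta ∘ y = beta ∘ y' -> y = y'.
Proof.
  intros fs chis L L' E.
  assert (fsK : forall z : hom T Y, f ∘ (s ∘ z) = z).
  { intros z; now rewrite comp_assoc, fs, comp_idl. }
  rewrite <- (fsK y), <- (fsK y'). f_equal.
  apply (@comma_paste_inj _ a); rewrite ?fsK; trivial.
  rewrite !comp_assoc, chis, <- !comp_assoc. now f_equal.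
Qed.

(** The comma object [L] of [alpha] and [f] is independent of [K] because a
    vertical comma functor comes with its own choice of comma objects. *)
Lemma comma_paste_comparison_iso (s : hom Y X) (t : hom V U) (P : C)
    (p1 : hom P Y) (p2 : hom P U) (gamma : hom X P)
    (L : comma_object alpha f) (N : comma_object alpha p1) (W : hom L N) :
  f ∘ s = idm Y -> chi ∘ s = t ∘ beta ->
  is_pullback beta g p1 p2 -> p1 ∘ gamma = f -> p2 ∘ gamma = chi ->
  induces (comma_pi1 N) (comma_pi2 N) (comma_pi1 L) (gamma ∘ comma_pi2 L) W ->
  is_iso W.
Proof.
  intros fs chis PB G1 G2 [W1 W2].
  pose proof (comma_le (comma_objP N)) as LN.
  assert (LU : beta ∘ alpha ∘ comma_pi1 N ≼ g ∘ (p2 ∘ comma_pi2 N)).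
  { rewrite (comp_assoc g), <- (pullback_comm PB), <- !comp_assoc.
    now apply le_postcomp. }
  destruct (comma_paste_lift LU) as [x [Lx Ex]].
  assert (Efx : f ∘ x = p1 ∘ comma_pi2 N).
  { apply (comma_paste_base_inj (a := comma_pi1 N) fs chis Lx LN).
    now rewrite !comp_assoc, square, (pullback_comm PB), <- !comp_assoc, Ex. }
  destruct (comma_pairP L Lx) as [R1 R2].
  exists (comma_pair L Lx); split; apply comma_ext;
    rewrite comp_assoc, comp_idr.
  - now rewrite R1.
  - rewrite R2.
    apply (@comma_paste_inj _ (comma_pi1 L)).
    + rewrite comp_assoc, Efx, <- comp_assoc, W2, comp_assoc, G1.
      apply (comma_le (comma_objP L)).
    + apply (comma_le (comma_objP L)).
    + now rewrite comp_assoc, Ex, <- comp_assoc, W2, comp_assoc, G2.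
  - now rewrite W1.
  - rewrite W2, <- comp_assoc, R2.
    apply (is_pullback_ext PB); rewrite comp_assoc; congruence.
Qed.

End Paste.

(** * The two implications *)

Lemma conservative_vertical_2pullback (C : ord_category)
    (cm : comma_objects C) (A Y V X U : C) (alpha : hom A Y) (beta : hom Y V)
    (f : hom X Y) (s : hom Y X) (g : hom U V) (t : hom V U) (chi : hom X U)
    (P : C) (p1 : hom P Y) (p2 : hom P U) :
  is_2pullback beta g p1 p2 -> conservative (vertical cm alpha) ->
  f ∘ s = idm Y -> g ∘ t = idm V ->
  beta ∘ f = g ∘ chi -> chi ∘ s = t ∘ beta ->
  forall K : comma_object alpha f,
    is_comma (beta ∘ alpha) g (comma_pi1 K) (chi ∘ comma_pi2 K) ->
    is_2pullback beta g f chi.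
Proof.
  intros HP Hcons fs gt square chis K HK.
  pose proof (proj1 HP) as PB.
  assert (Esig : beta ∘ idm Y = g ∘ (t ∘ beta)).
  { now rewrite comp_assoc, gt, comp_idl, comp_idr. }
  destruct (pullback_univ PB Esig) as [sigma [[S1 S2] _]].
  destruct (pullback_univ PB square) as [gamma [[G1 G2] _]].
  assert (Gsec : gamma ∘ s = sigma).
  { apply (is_pullback_ext PB); rewrite comp_assoc; congruence. }
  pose (q := Point fs : Pt Y). pose (p := Point S1 : Pt Y).
  pose (u := @PointHom C Y q p gamma G1 Gsec : hom q p).
  enough (Hu : is_iso gamma).
  { rewrite <- G1, <- G2. now apply is_2pullback_precomp_iso. }
  apply (proj2 (point_hom_iso u)), Hcons, point_hom_iso.
  exact (comma_paste_comparison_iso square HK fs chis PB G1 G2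
    (vertical_fmapP cm alpha u)).
Qed.

Theorem theorem2p5 (C : ord_category)
    (fin_complete : finitely_complete C)
    (cm : comma_objects C)
    (pb2 : admits_2pullbacks C) :
  (forall (A Y : C) (alpha : hom A Y), conservative (vertical cm alpha))
  <->
  (forall (A Y V X U : C) (alpha : hom A Y) (beta : hom Y V)
     (f : hom X Y) (s : hom Y X) (g : hom U V) (t : hom V U) (chi : hom X U),
     f ∘ s = idm Y -> g ∘ t = idm V ->
     beta ∘ f = g ∘ chi -> chi ∘ s = t ∘ beta ->
     forall K : comma_object alpha f,
       is_comma (beta ∘ alpha) g (comma_pi1 K) (chi ∘ comma_pi2 K) ->
       is_2pullback beta g f chi).
Proof.
  split.
  - intros Hcons A Y V X U alpha beta f s g t chi fs gt square chis K HK.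
    destruct (pb2 _ _ _ beta g) as [P [p1 [p2 HP]]].
    exact (conservative_vertical_2pullback HP (Hcons _ _ alpha)
      fs gt square chis HK).
  - intros H A Y alpha q p u Hu.
    apply point_hom_iso in Hu. apply point_hom_iso.
    destruct (vertical_fmapP cm alpha u) as [W1 W2].
    set (Kq := cm A Y _ alpha (pt_map q)) in *.
    assert (HK : is_comma (idm Y ∘ alpha) (pt_map p)
                   (comma_pi1 Kq) (pt_mor u ∘ comma_pi2 Kq)).
    { rewrite comp_idl, <- W1, <- W2.
      apply is_comma_precomp_iso; [apply comma_objP | exact Hu]. }
    assert (square : idm Y ∘ pt_map q = pt_map p ∘ pt_mor u)
      by now rewrite comp_idl, pt_mor_map.
    assert (sections : pt_mor u ∘ pt_sec q = pt_sec p ∘ idm Y)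
      by now rewrite comp_idr, pt_mor_sec.
    destruct (H _ _ _ _ _ _ _ _ _ _ _ _ (pt_secK q) (pt_secK p)
      square sections Kq HK) as [PB _].
    exact (is_pullback_along_id_iso PB).
Qed.
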